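(* The quadratic polarization constant relative to $\mathfrak O$ is $$\mathbf c_2(\mathfrak O)=2.$$ The constant is attained by $P_*(x,y)=-x^2+4xy-y^2$ and by its negative; that is, $\|\check P\|_{\mathfrak O,\mathrm{bil}}=2\|P\|_{\mathfrak O}$ for $P=\pm P_*$.
   Context: $\mathfrak O:=\{(x,y)\in[0,1]^2: x+y\le\sqrt2\}$. For a real quadratic form $P(x,y)=ax^2+bxy+cy^2$ put $\|P\|_{\mathfrak O}:=\sup_{(x,y)\in\mathfrak O}|P(x,y)|$. Its associated symmetric bilinear form is $$\check P((x_1,y_1),(x_2,y_2))=ax_1x_2+\frac b2(x_1y_2+x_2y_1)+cy_1y_2,$$ with relative bilinear norm $\|\check P\|_{\mathfrak O,\mathrm{bil}}:=\sup\{|\check P(z,w)|: z,w\in\mathfrak O\}$. The quadratic polarization constant relative to $\mathfrak O$ is $$\mathbf c_2(\mathfrak O):=\sup_{P\ne0}\frac{\|\check P\|_{\mathfrak O,\mathrm{bil}}}{\|P\|_{\mathfrak O}},$$ the supremum being over nonzero real quadratic forms in two variables. *)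

(* Defs.v *)
From mathcomp Require Import all_boot all_order all_algebra.
From mathcomp Require Import lra.
From mathcomp Require Import all_classical all_reals ereal.

Set Implicit Arguments.
Unset Strict Implicit.
Unset Printing Implicit Defensive.

Import Order.TTheory GRing.Theory Num.Theory.

Local Open Scope classical_set_scope.
Local Open Scope ring_scope.

Definition octagon (R : realType) : set (R * R) :=
  [set z | [/\ 0 <= z.1 <= 1, 0 <= z.2 <= 1 & z.1 + z.2 <= Num.sqrt 2]].
Arguments octagon : clear implicits.

(* The triple (a, b, c) stands for the form a x^2 + b x y + c y^2; zero and
   opposite are those of the product group (see [qeval_eq0] and [qevalN]). *)
Definition qform (R : realType) : Type := (R * R * R)%type.

Definition QForm (R : realType) (a b c : R) : qform R := (a, b, c).

Definition qeval (R : realType) (P : qform R) (z : R * R) : R :=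
  let: (a, b, c) := P in
  a * z.1 ^+ 2 + b * z.1 * z.2 + c * z.2 ^+ 2.

Definition qpolar (R : realType) (P : qform R) (z w : R * R) : R :=
  let: (a, b, c) := P in
  a * z.1 * w.1 + b / 2 * (z.1 * w.2 + w.1 * z.2) + c * z.2 * w.2.

Definition qnorm (R : realType) (P : qform R) : R :=
  sup [set `|qeval P z| | z in octagon R].

Definition bilnorm (R : realType) (P : qform R) : R :=
  sup [set `|qpolar P zw.1 zw.2| | zw in octagon R `*` octagon R].

(* An extended-real supremum, so that finiteness is part of any claim about
   its value. The quotients are genuine by [has_sup_qnorm], [has_sup_bilnorm]
   and [qnorm_gt0]. *)
Definition polarization_constant (R : realType) : \bar R :=
  ereal_sup [set (bilnorm P / qnorm P)%:E | P in [set P : qform R | P != 0]].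

Definition Pstar (R : realType) : qform R := QForm (- 1) 4 (- 1).

Section Sanity.
Variable R : realType.
Implicit Types (P : qform R) (z w : R * R).

Lemma qevalN P z : qeval (- P) z = - qeval P z.
Proof. by case: P => [[a b] c]; rewrite /qeval /=; lra. Qed.

Lemma qpolarzz P z : qpolar P z z = qeval P z.
Proof. by case: P => [[a b] c]; rewrite /qpolar /qeval /=; lra. Qed.

Lemma qpolarN P z w : qpolar (- P) z w = - qpolar P z w.
Proof. by case: P => [[a b] c]; rewrite /qpolar /=; lra. Qed.

Lemma sqrt2_ge1 : 1 <= Num.sqrt 2 :> R.
Proof. by rewrite -[leLHS]sqrtr1 ler_sqrt ?ler1n. Qed.

Lemma octagon10 : octagon R (1, 0).
Proof. by have := sqrt2_ge1; split => /=; lra. Qed.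

Lemma octagon01 : octagon R (0, 1).
Proof. by have := sqrt2_ge1; split => /=; lra. Qed.

Lemma octagon_half : octagon R (1 / 2, 1 / 2).
Proof. by have := sqrt2_ge1; split => /=; lra. Qed.

Lemma qeval_eq0 P : (forall z, octagon R z -> qeval P z = 0) <-> P = 0.
Proof.
split=> [P0|-> z _]; last by rewrite /qeval /=; lra.
case: P P0 => [[a b] c] P0.
have := P0 _ octagon10; have := P0 _ octagon01; have := P0 _ octagon_half.
rewrite /qeval /= => h1 h2 h3.
have -> : a = 0 by lra.
have -> : c = 0 by lra.
by have -> : b = 0 by lra.
Qed.

Lemma qpolar_le P z w : octagon R z -> octagon R w ->
  `|qpolar P z w| <= `|P.1.1| + `|P.1.2| + `|P.2|.
Proof.
case: P z w => [[a b] c] [x1 y1] [x2 y2] [/= hx1 hy1 _] [/= hx2 hy2 _].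
have M (u v : R) : 0 <= u <= 1 -> 0 <= v <= 1 -> 0 <= u * v <= 1.
  move=> /andP[u0 u1] /andP[v0 v1].
  by rewrite mulr_ge0 //= mulr_ile1.
have T (k u : R) : 0 <= u <= 1 -> `|k * u| <= `|k|.
  by move=> /andP[u0 u1]; rewrite normrM (ger0_norm u0) ler_piMr.
have -> : a * x1 * x2 + b / 2 * (x1 * y2 + x2 * y1) + c * y1 * y2 =
    a * (x1 * x2) + b * ((x1 * y2 + x2 * y1) / 2) + c * (y1 * y2) by lra.
apply: (le_trans (ler_normD _ _)); apply: lerD; last exact/T/M.
apply: (le_trans (ler_normD _ _)); apply: lerD; first exact/T/M.
apply: T; have := M _ _ hx1 hy2; have := M _ _ hx2 hy1; lra.
Qed.

Lemma has_sup_bilnorm P :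
  has_sup [set `|qpolar P zw.1 zw.2| | zw in octagon R `*` octagon R].
Proof.
split; first by exists `|qpolar P (1, 0) (1, 0)|, ((1, 0), (1, 0)) => //;
  split; exact: octagon10.
exists (`|P.1.1| + `|P.1.2| + `|P.2|) => _ [[z w] [/= hz hw] <-].
exact: qpolar_le.
Qed.

Lemma has_sup_qnorm P : has_sup [set `|qeval P z| | z in octagon R].
Proof.
split; first by exists `|qeval P (1, 0)|, (1, 0) => //; exact: octagon10.
exists (`|P.1.1| + `|P.1.2| + `|P.2|) => _ [z hz <-].
by rewrite -qpolarzz; exact: qpolar_le.
Qed.

Lemma qnorm_gt0 P : P != 0 -> 0 < qnorm P.
Proof.
apply: contraNT; rewrite -leNgt => N0; apply/eqP/qeval_eq0 => z hz.
apply/eqP; rewrite -normr_le0; apply: le_trans N0.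
by apply: ub_le_sup; [exact: (has_sup_qnorm P).2 | exists z].
Qed.

Lemma Pstar_neq0 : Pstar R != 0.
Proof.
apply/eqP => /qeval_eq0 /(_ _ octagon10); rewrite /qeval /=; lra.
Qed.

End Sanity.

(* Main.v *)
(** The value of a form [a x^2 + b x y + c y^2] at [(1, 0)], [(0, 1)] and at the
    midpoint [(r, r)], [r = sqrt 2 / 2], of the slanted edge bounds [a], [c] and
    [(a + b + c) / 2] by its norm [N]. Putting [A = x1 x2], [B = x1 y2 + x2 y1]
    and [C = y1 y2], the polar form is
    [(a + b + c) / 2 * B + a (A - B / 2) + c (C - B / 2)], so it is at most
    [N (B + |A - B / 2| + |C - B / 2|)], and that weight is at most [2]. For
    [P = -x^2 + 4 x y - y^2] the norm is [1] while the polar form takes the value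
    [2] at the pair [(1, 0)], [(0, 1)]. *)
Require Import Defs.
From mathcomp Require Import all_boot all_order all_algebra.
From mathcomp Require Import lra ring.
From mathcomp Require Import all_classical all_reals ereal.

Import Order.TTheory GRing.Theory Num.Theory.

Local Open Scope classical_set_scope.
Local Open Scope ring_scope.

Section Polarization.
Variable R : realType.
Implicit Types (P : qform R) (z w : R * R).

Local Notation s2 := (Num.sqrt 2 : R).

Lemma sqr_sqrt2 : s2 * s2 = 2.
Proof. by rewrite -expr2 sqr_sqrtr ?ler0n. Qed.

(** The rational bound [3 / 2] is exactly what gives [2 * s2 - 1 <= 2] in [octagon_mixed_le]. *)
Lemma sqrt2_le32 : s2 <= 3 / 2.
Proof. have := sqrt2_ge1 R; have := sqr_sqrt2; nra. Qed.

Lemma octagon_diag : octagon R (s2 / 2, s2 / 2).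
Proof. by have := sqrt2_ge1 R; have := sqrt2_le32; split => /=; lra. Qed.

Lemma qeval_le_qnorm P z : octagon R z -> `|qeval P z| <= qnorm P.
Proof. by move=> hz; apply: ub_le_sup; [exact: (has_sup_qnorm P).2 | exists z]. Qed.

Lemma qpolar_le_bilnorm P z w :
  octagon R z -> octagon R w -> `|qpolar P z w| <= bilnorm P.
Proof.
by move=> hz hw; apply: ub_le_sup; [exact: (has_sup_bilnorm P).2 | exists (z, w)].
Qed.

Lemma qnorm_le P k :
  (forall z, octagon R z -> `|qeval P z| <= k) -> qnorm P <= k.
Proof. by move=> h; apply: ge_sup (has_sup_qnorm P).1 _ => _ [z hz <-]; exact: h. Qed.

Lemma bilnorm_le P k :
  (forall z w, octagon R z -> octagon R w -> `|qpolar P z w| <= k) ->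
  bilnorm P <= k.
Proof.
move=> h; apply: ge_sup (has_sup_bilnorm P).1 _ => _ [[z w] [/= hz hw] <-].
exact: h.
Qed.

Lemma qnormN P : qnorm (- P) = qnorm P.
Proof. by congr sup; apply: eq_imagel => z _; rewrite qevalN normrN. Qed.

Lemma bilnormN P : bilnorm (- P) = bilnorm P.
Proof. by congr sup; apply: eq_imagel => zw _; rewrite qpolarN normrN. Qed.

(** Grouped as [x1 (x2 + y2) + y1 (x2 - y2)], the form is at most
    [x1 s2 + y1 = (x1 + y1) + x1 (s2 - 1)], hence at most [2 s2 - 1]. *)
Lemma octagon_mixed_le z w : octagon R z -> octagon R w ->
  z.1 * w.1 - z.2 * w.2 + (z.1 * w.2 + w.1 * z.2) <= 2.
Proof.
case: z w => [x1 y1] [x2 y2] [/= /andP[? ?] /andP[? ?] h1] [/= /andP[? ?] /andP[? ?] h2].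
have h := sqrt2_le32.
have : x1 * (x2 + y2) <= x1 * s2 by rewrite ler_wpM2l.
have : y1 * (x2 - y2) <= y1 * 1 by rewrite ler_wpM2l //; lra.
have : x1 * (s2 - 1) <= 1 * (s2 - 1).
  by rewrite ler_wpM2r //; have := sqrt2_ge1 R; lra.
lra.
Qed.

(* The form is [x1 p + y1 q] with [p = 2 y2 - x2 <= 2], [q = 2 x2 - y2 <= 2]
   and [p + q = x2 + y2 <= sqrt 2]. *)
Lemma octagon_cross_le z w : octagon R z -> octagon R w ->
  2 * (z.1 * w.2 + w.1 * z.2) - z.1 * w.1 - z.2 * w.2 <= 2.
Proof.
case: z w => [x1 y1] [x2 y2] [/= /andP[? ?] /andP[? ?] _] [/= /andP[? ?] /andP[? ?] h2].
have h := sqrt2_le32.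
set p := 2 * y2 - x2; set q := 2 * x2 - y2.
have -> : 2 * (x1 * y2 + x2 * y1) - x1 * x2 - y1 * y2 = x1 * p + y1 * q.
  by rewrite /p /q; ring.
have xp : x1 * p <= Num.max 0 p.
  rewrite le_max; case: (leP p 0) => hp; first by rewrite mulr_ge0_le0.
  by rewrite [X in _ || X]ler_piMl ?orbT // ltW.
have yq : y1 * q <= Num.max 0 q.
  rewrite le_max; case: (leP q 0) => hq; first by rewrite mulr_ge0_le0.
  by rewrite [X in _ || X]ler_piMl ?orbT // ltW.
apply: le_trans (lerD xp yq) _; rewrite /p /q.
by case: (leP 0 _) => ?; case: (leP 0 _) => ?; lra.
Qed.

(** With [A], [B], [C] as in the overview, the signs of the two absolute values leave four cases:
    [A + C], [A - C + B], [C - A + B] and [2 B - A - C]. Each is bounded by 2 separately. *)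
Lemma octagon_weight_le z w : octagon R z -> octagon R w ->
  z.1 * w.2 + w.1 * z.2 +
  `|z.1 * w.1 - (z.1 * w.2 + w.1 * z.2) / 2| +
  `|z.2 * w.2 - (z.1 * w.2 + w.1 * z.2) / 2| <= 2.
Proof.
move=> hz hw; set B := _ + w.1 * z.2; have cross := octagon_cross_le _ _ hz hw.
have mixed := octagon_mixed_le _ _ hz hw.
(* Swapping the coordinates preserves the octagon, fixes [B] and exchanges [A] with [C]. *)
have mixed' : z.2 * w.2 - z.1 * w.1 + B <= 2.
  have sw u : octagon R u -> octagon R (u.2, u.1).
    by case=> h1 h2 h3; split=> //=; rewrite addrC.
  by have := octagon_mixed_le _ _ (sw _ hz) (sw _ hw); rewrite /= /B; lra.
have diag : z.1 * w.1 + z.2 * w.2 <= 2.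
  case: hz hw => /andP[? ?] /andP[? ?] _ [/andP[? ?] /andP[? ?] _].
  by rewrite -[leRHS]/(1 + 1) lerD // mulr_ile1.
rewrite -/B in cross mixed.
by case: (ler0P (z.1 * w.1 - B / 2)) => ?; case: (ler0P (z.2 * w.2 - B / 2)) => ?; lra.
Qed.

Lemma bilnorm_le_qnorm P : bilnorm P <= 2 * qnorm P.
Proof.
apply: bilnorm_le => z w hz hw.
have ha := qeval_le_qnorm P _ (octagon10 R).
have hc := qeval_le_qnorm P _ (octagon01 R).
have hm := qeval_le_qnorm P _ octagon_diag.
have W := octagon_weight_le _ _ hz hw.
have B0 : 0 <= z.1 * w.2 + w.1 * z.2.
  case: hz hw => /andP[? ?] /andP[? ?] _ [/andP[? ?] /andP[? ?] _].
  by rewrite addr_ge0 // mulr_ge0.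
set N := qnorm P in ha hc hm *; have N0 : 0 <= N := le_trans (normr_ge0 _) ha.
case: P @N N0 ha hc hm => [[a b] c] N N0; rewrite /qeval /qpolar /=.
have -> : a * 1 ^+ 2 + b * 1 * 0 + c * 0 ^+ 2 = a by ring.
have -> : a * 0 ^+ 2 + b * 0 * 1 + c * 1 ^+ 2 = c by ring.
have -> : a * (s2 / 2) ^+ 2 + b * (s2 / 2) * (s2 / 2) + c * (s2 / 2) ^+ 2 =
    (a + b + c) / 2.
  (* Writing 2 as [s2 * s2] leaves an identity in which [s2] is a mere indeterminate, as [field]
     requires. *)
  have -> : (a + b + c) / 2 = (a + b + c) / 4 * (s2 * s2) by rewrite sqr_sqrt2; lra.
  by field.
move=> ha hc hm.
set A := z.1 * w.1; set C := z.2 * w.2; set B := _ + w.1 * z.2 in B0 W *.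
have -> : a * z.1 * w.1 + b / 2 * B + c * z.2 * w.2 =
    (a + b + c) / 2 * B + a * (A - B / 2) + c * (C - B / 2).
  by rewrite /A /C; field.
apply: le_trans (_ : N * (B + `|A - B / 2| + `|C - B / 2|) <= _); last first.
  by rewrite mulrC ler_wpM2r.
rewrite (mulrDr N (B + _)) (mulrDr N B); apply: le_trans (ler_normD _ _) _; apply: lerD.
  apply: le_trans (ler_normD _ _) _; apply: lerD; last by rewrite normrM ler_wpM2r.
  by rewrite normrM (ger0_norm B0) ler_wpM2r.
by rewrite normrM ler_wpM2r.
Qed.

(** Above, the form equals [(x + y)^2 / 2 - 3 (x - y)^2 / 2], and [(x + y)^2 <= 2]. Below, the
    smaller squared coordinate is at most [x y], so the negated form is at most the larger
    square. *)
Lemma qnorm_Pstar_le1 : qnorm (Pstar R) <= 1.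
Proof.
apply: qnorm_le => -[x y] [/= /andP[x0 x1] /andP[y0 y1] xy].
have xy2 : (x + y) * (x + y) <= 2 by rewrite -sqr_sqrt2 ler_pM // addr_ge0.
rewrite /qeval /= ler_norml; apply/andP; split; last first.
  by have := sqr_ge0 (x - y); lra.
have [? ?] : x * x <= 1 /\ y * y <= 1 by rewrite !mulr_ile1.
have [xley|/ltW ylex] := leP x y.
  by have : x * x <= x * y; [rewrite ler_wpM2l | have := mulr_ge0 x0 y0; lra].
by have : y * y <= y * x; [rewrite ler_wpM2l | have := mulr_ge0 x0 y0; lra].
Qed.

Lemma bilnorm_Pstar_ge2 : 2 <= bilnorm (Pstar R).
Proof.
apply: le_trans (qpolar_le_bilnorm _ _ _ (octagon10 R) (octagon01 R)).
by apply: le_trans (ler_norm _); rewrite /qpolar /=; lra.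
Qed.

(** The chain [2 <= bilnorm <= 2 * qnorm <= 2] collapses to equalities. *)
Lemma bilnorm_Pstar : bilnorm (Pstar R) = 2 * qnorm (Pstar R).
Proof.
apply/eqP; rewrite eq_le bilnorm_le_qnorm /=.
by have := bilnorm_Pstar_ge2; have := qnorm_Pstar_le1; lra.
Qed.

End Polarization.

Theorem theorem5p4 (R : realType) :
  [/\ polarization_constant R = 2%:E,
      bilnorm (Pstar R) = 2 * qnorm (Pstar R)
    & bilnorm (- Pstar R) = 2 * qnorm (- Pstar R)].
Proof.
split; [|exact: bilnorm_Pstar|by rewrite bilnormN qnormN bilnorm_Pstar].
apply/eqP; rewrite eq_le; apply/andP; split.
  apply: ge_ereal_sup => _ [P /= P0 <-].
  by rewrite lee_fin ler_pdivrMr ?qnorm_gt0 // bilnorm_le_qnorm.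
apply: ereal_sup_ubound; exists (Pstar R); first exact: Pstar_neq0.
by rewrite bilnorm_Pstar mulfK // gt_eqF // qnorm_gt0 // Pstar_neq0.
Qed.
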